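(* Suppose that the Doeblin graph $\mathbf G$ is almost surely connected. Then $\mathbf G$ contains a unique (up to measure zero modifications) state path $(\beta_t)_{t\in\mathbb Z}$ that is bi-recurrent for $x^*$. Moreover, $(\beta_t)_{t\in\mathbb Z}$ is shift-covariant and stationary, and for each $t\in\mathbb Z$, $\beta_t$ is measurable with respect to $\sigma(\xi_s:s<t)$. Additionally, $(\beta_t)_{t\in\mathbb Z}$ is bi-recurrent for every $x\in S$ that is positive recurrent.
   Context: Doeblin graph. Let $(\Omega,\mathcal F,\mathbb P)$ be a probability space, $S$ a countable set, $\Xi$ a complete separable metric space, $h:S\times\Xi\to S$ a measurable map, and $\xi=(\xi_t)_{t\in\mathbb Z}$ a stationary and ergodic sequence of $\Xi$-valued random variables. The Doeblin graph $\mathbf G$ has vertex set $\mathbb Z\times S$ and a directed edge from each $(t,x)$ to $f_+(t,x):=(t+1,h(x,\xi_t))$. For $s\ge t$, $F^{(t,x)}_s\in S$ is defined by $(s,F^{(t,x)}_s)=f_+^{\,s-t}(t,x)$. Connectedness refers to the underlying undirected graph. A state $x$ is positive recurrent if $\mathbb E[\inf\{s>0:F^{(0,x)}_s=x\}]<\infty$. A positive recurrent state $x^*\in S$ is assumed to exist and is fixed. State paths. A state path in $\mathbf G$ (over $\mathbb Z$) is an $S$-valued stochastic process $(X_t)_{t\in\mathbb Z}$ on $\Omega$ such that $(t,X_t)_{t\in\mathbb Z}$ is a.s. a (directed) path in $\mathbf G$. It is bi-recurrent for $x$ if a.s. $\{t\in\mathbb Z:X_t=x\}$ is unbounded above and below.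 A $\xi$-measurable subgraph $\Gamma=\Gamma((\xi_t)_{t\in\mathbb Z})$ of $\mathbf G$ is shift-covariant if for all $s\in\mathbb Z$, $\Gamma((\xi_{t+s})_{t\in\mathbb Z})$ is a.s. the time-translation of $\Gamma$ by $-s$; a state path is shift-covariant if the corresponding path in $\mathbf G$ is. *)

(* Defs.v *)
From HB Require Import structures.
From mathcomp Require Import all_boot all_order all_algebra.
From mathcomp Require Import all_classical all_reals all_analysis.

Set Implicit Arguments.
Unset Strict Implicit.
Unset Printing Implicit Defensive.

Import Order.TTheory GRing.Theory Num.Theory.

Local Open Scope classical_set_scope.
Local Open Scope ring_scope.

(* Nonemptiness, demanded by measurable types, comes from [CompletePseudoMetric]. *)
#[short(type="completeMetricType")]
HB.structure Definition CompleteMetric (R : numDomainType) :=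
  { T of Metric R T & CompletePseudoMetric R T }.

Definition separable_space (T : topologicalType) : Prop :=
  exists2 D : set T, countable D & dense D.

Notation borelType T := (g_sigma_algebraType (@open T)).

Section Processes.

Definition sigma_process {O : Type} {d : measure_display}
    {T : measurableType d} (I : set int) (X : int -> O -> T) : set (set O) :=
  <<s \bigcup_(t in I) preimage_set_system [set: O] (X t) measurable >>.

(* The product sigma-algebra on T^Z is the one generated by the coordinates. *)
Definition product_measurable {d : measure_display} {T : measurableType d} :
    set (set (int -> T)) :=
  sigma_process setT (fun (t : int) (z : int -> T) => z t).

Definition shift {T : Type} (s : int) (z : int -> T) : int -> T :=
  fun t => z (t + s).

Context {d : measure_display} {O : measurableType d} {R : realType}.
Variable P : probability O R.
Context {d' : measure_display} {T : measurableType d'}.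

Definition stationary (X : int -> O -> T) : Prop :=
  forall (s : int) (A : set (int -> T)), product_measurable A ->
    P [set w | A (shift s (X ^~ w))] = P [set w | A (X ^~ w)].

Definition ergodic (X : int -> O -> T) : Prop :=
  forall A : set (int -> T), product_measurable A -> shift 1 @^-1` A = A ->
    P [set w | A (X ^~ w)] = 0%E \/ P [set w | A (X ^~ w)] = 1%E.

End Processes.

Section DoeblinGraph.
Context {S : choiceType} {Xi : Type}.
Variable h : S * Xi -> S.

Definition fplus (z : int -> Xi) (v : int * S) : int * S :=
  (v.1 + 1, h (v.2, z v.1)).

Definition edge (z : int -> Xi) : rel (int * S) :=
  [rel u v | fplus z u == v].

Definition adjacent (z : int -> Xi) : rel (int * S) :=
  [rel u v | edge z u v || edge z v u].

Definition connected_graph (z : int -> Xi) : Prop :=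
  forall u v : int * S,
    exists2 p : seq (int * S), path (adjacent z) u p & last u p = v.

(* F z (t, x) s is only meaningful for t <= s. *)
Definition F (z : int -> Xi) (v : int * S) (s : int) : S :=
  (iter `|s - v.1|%N (fplus z) v).2.

(* Valued in \bar R, so that the infimum over the empty set is +oo. *)
Definition return_time (R : realType) (z : int -> Xi) (x : S) : \bar R :=
  ereal_inf [set (s%:~R : R)%:E
            | s in [set s : int | 0 < s /\ F z (0, x) s = x]].

Record digraph : Type := Digraph {
  vertices : set (int * S);
  edges : set ((int * S) * (int * S))
}.

Definition is_subgraph (z : int -> Xi) (G : digraph) : Prop :=
  forall u v, edges G (u, v) -> [/\ vertices G u, vertices G v & edge z u v].

Definition translate_vertex (s : int) (v : int * S) : int * S := (v.1 + s, v.2).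

Definition translate (s : int) (G : digraph) : digraph :=
  Digraph (translate_vertex s @` vertices G)
    [set (translate_vertex s e.1, translate_vertex s e.2) | e in edges G].

Definition path_digraph (X : int -> S) : digraph :=
  Digraph [set (t, X t) | t in [set: int]]
    [set ((t, X t), (t + 1, X (t + 1))) | t in [set: int]].

End DoeblinGraph.

Section StatePaths.
Context {d : measure_display} {O : measurableType d} {R : realType}.
Variable P : probability O R.
Context {dS : measure_display} {S : measurableType dS}.
Context {dX : measure_display} {Xi : measurableType dX}.
Variables (h : S * Xi -> S) (xi : int -> O -> Xi).

Definition positive_recurrent (x : S) : Prop :=
  (\int[P]_w return_time h R (xi ^~ w) x < +oo)%E.

Definition state_path (X : int -> O -> S) : Prop :=
  (forall t, measurable_fun setT (X t)) /\
  \forall w \ae P, forall t, edge h (xi ^~ w) (t, X t w) (t + 1, X (t + 1) w).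

Definition bi_recurrent (X : int -> O -> S) (x : S) : Prop :=
  \forall w \ae P, ~ has_ubound [set t | X t w = x] /\
                   ~ has_lbound [set t | X t w = x].

(* A random subgraph that is a measurable function of the sequence xi is given
   by the map Gam from Xi^Z to digraphs; measurability is that of each event
   "this vertex (or edge) is present". *)
Definition xi_measurable_subgraph (Gam : (int -> Xi) -> @digraph S) : Prop :=
  [/\ forall v, product_measurable [set z | vertices (Gam z) v],
      forall e, product_measurable [set z | edges (Gam z) e] &
      \forall w \ae P, is_subgraph h (xi ^~ w) (Gam (xi ^~ w))].

Definition shift_covariant_subgraph (Gam : (int -> Xi) -> @digraph S) : Prop :=
  forall s : int, \forall w \ae P,
    Gam (shift s (xi ^~ w)) = translate (- s) (Gam (xi ^~ w)).

Definition shift_covariant_path (X : int -> O -> S) : Prop :=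
  exists Gam : (int -> Xi) -> @digraph S,
    [/\ xi_measurable_subgraph Gam,
        shift_covariant_subgraph Gam &
        forall w, path_digraph (X ^~ w) = Gam (xi ^~ w)].

End StatePaths.

(* Main.v *)
(* The path beta is obtained by coupling from the past: beta_t is the eventual
   value, as n grows, of the state at time t of the path started from
   (t - n, xstar).  Since the return time tau to xstar has finite mean,
   sum_k P(tau > k) < oo, so by Borel-Cantelli and stationarity only finitely
   many of the paths started from (-k, xstar) miss xstar during (-k, 0]; hence
   all of them pass through finitely many vertices (-j, xstar), and
   connectedness merges these at a finite time u.  The event "the value at time
   t is eventually constant" thus occurs for some t; it increases with t and has
   the same probability for all t, so it occurs almost surely for every t.  The
   same monotonicity-plus-stationarity argument turns forward recurrence of
   beta (it merges with a recurrent path) into backward recurrence.  A path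
   visiting xstar at arbitrarily negative times coincides with beta by
   construction of the latter. *)
Require Import Defs.
From HB Require Import structures.
From mathcomp Require Import all_boot all_order all_algebra.
From mathcomp Require Import all_classical all_reals all_analysis.
From mathcomp Require Import measurable_realfun zify.

Set Implicit Arguments.
Unset Strict Implicit.
Unset Printing Implicit Defensive.

Import Order.TTheory GRing.Theory Num.Theory.

Local Open Scope classical_set_scope.
Local Open Scope ring_scope.

(* MathComp-Analysis has its own [shift]. *)
Local Notation shift := Defs.shift.

Lemma int_geP (t s : int) : t <= s -> exists n : nat, s = t + n%:Z.
Proof. by move=> ts; exists `|s - t|%N; lia. Qed.

Lemma shiftD {T : Type} (a b : int) (z : int -> T) :
  shift a (shift b z) = shift (a + b) z.
Proof. by apply/funext => t; rewrite /shift addrA. Qed.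

(** * Deterministic paths of the Doeblin graph *)

Section Trajectories.
Context {S : choiceType} {Xi : Type}.
Context (h : S * Xi -> S).
Implicit Types (z : int -> Xi) (x y : S) (t s r : int).

Lemma FD z t x (n : nat) : F h z (t, x) (t + n%:Z) = (iter n (fplus h z) (t, x)).2.
Proof. by rewrite /F /=; congr ((iter _ _ _).2); lia. Qed.

Lemma iter_fplusE z t x (n : nat) :
  iter n (fplus h z) (t, x) = (t + n%:Z, F h z (t, x) (t + n%:Z)).
Proof.
rewrite FD; elim: n => [|n IHn]; first by rewrite addr0.
by rewrite iterS IHn /fplus /=; congr pair; lia.
Qed.

Lemma F_refl z t x : F h z (t, x) t = x.
Proof. by rewrite -[X in F _ _ _ X]addr0 (FD _ _ _ 0). Qed.

Lemma F_step z t x s : t <= s -> F h z (t, x) (s + 1) = h (F h z (t, x) s, z s).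
Proof.
move=> /int_geP[n ->]; have -> : t + n%:Z + 1 = t + n.+1%:Z by lia.
by rewrite FD iterS iter_fplusE.
Qed.

Lemma F_trans z t x s r : t <= s -> s <= r ->
  F h z (t, x) r = F h z (s, F h z (t, x) s) r.
Proof.
move=> /int_geP[n ->] /int_geP[m ->]; rewrite FD -iter_fplusE -iterD.
by rewrite -FD; congr F; lia.
Qed.

Arguments F_trans {z t x} s {r}.

Lemma F_shift a z t x s : t <= s ->
  F h (shift a z) (t, x) s = F h z (t + a, x) (s + a).
Proof.
move=> /int_geP[n ->]; elim: n => [|n IHn]; first by rewrite addr0 !F_refl.
have -> : t + n.+1%:Z = t + n%:Z + 1 by lia.
rewrite F_step ?IHn; last by lia.
have -> : t + n%:Z + 1 + a = t + n%:Z + a + 1 by lia.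
by rewrite F_step //; lia.
Qed.

Lemma path_F z (X : int -> S) :
  (forall t, X (t + 1) = h (X t, z t)) ->
  forall t s, t <= s -> X s = F h z (t, X t) s.
Proof.
move=> Xstep t s /int_geP[n ->]; elim: n => [|n IHn].
  by rewrite addr0 F_refl.
have -> : t + n.+1%:Z = t + n%:Z + 1 by lia.
by rewrite Xstep IHn -F_step //; lia.
Qed.

(* In a graph of out-degree one, connected vertices have a common descendant. *)
Lemma connected_merge z : connected_graph h z -> forall u v : int * S,
  exists n m, iter n (fplus h z) u = iter m (fplus h z) v.
Proof.
move=> cz u v; have [p] := cz u v.
elim: p u => [|a p IHp] u /= => [_ ->|/andP[ua ap] av]; first by exists 0%N, 0%N.
have [n [m nm]] := IHp _ ap av.
case/orP: ua => /eqP e; first by exists n.+1, m; rewrite iterSr e.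
(* For a backward edge [a -> u], drop one step from the path of [a]; when [a] is itself the common
   descendant, prolong the path of [v] by one step instead. *)
case: n nm => [|n] nm.
  by exists 0%N, m.+1; rewrite iterS -nm /= e.
by exists n, m; rewrite -nm iterSr e.
Qed.

(** A common descendant has a single time coordinate, and out-degree one keeps two paths together
    once they meet. *)
Lemma connected_coalesce z : connected_graph h z -> forall t s x y,
  exists r0, [/\ t <= r0, s <= r0 &
    forall r, r0 <= r -> F h z (t, x) r = F h z (s, y) r].
Proof.
move=> cz t s x y; have [n [m]] := connected_merge cz (t, x) (s, y).
rewrite !iter_fplusE => -[e1 e2]; exists (t + n%:Z); split; [lia|lia|].
move=> r rge; rewrite (F_trans (t + n%:Z) _ rge); last by lia.
rewrite e2 e1 -(F_trans (s + m%:Z)) //; lia.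
Qed.

(** * Returns to a state and coalescence *)

Definition recurrent_paths z x :=
  forall t, exists2 j : nat, (0 < j)%N & F h z (t, x) (t + j%:Z) = x.

Lemma recurrent_paths_unbounded z x : recurrent_paths z x ->
  forall t r, exists2 s, r <= s & t <= s /\ F h z (t, x) s = x.
Proof.
move=> rx t r; have [rt|/int_geP[n ->]] : r <= t \/ t <= r by lia.
  by exists t => //; rewrite F_refl.
elim: n => [|n [s ns [ts Fs]]]; first by exists t; rewrite ?addr0 ?F_refl.
have [j j0 Fj] := rx s; exists (s + j%:Z); [lia|split; first lia].
by rewrite (F_trans s ts) ?Fs //; lia.
Qed.

(** The event [tau > k] for the return time tau to [x]. As a set of sequences it can be shifted: by
    [-k], it says that the path from [(-k, x)] misses [x] during [(-k, 0]]. *)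
Definition no_return x (k : nat) : set (int -> Xi) :=
  [set z | forall j : nat, (0 < j <= k)%N -> F h z (0, x) j%:Z <> x].

(* With only finitely many paths (-k, x) missing x on (-k, 0], every earlier
   path passes through x in a bounded window before time 0. *)
Lemma finite_window z x (K : nat) :
  (forall k, (K <= k)%N -> ~ no_return x k (shift (- k%:Z) z)) ->
  forall k : nat, exists2 j : nat, (j <= K)%N & (j <= k)%N /\
    F h z (- k%:Z, x) (- j%:Z) = x.
Proof.
move=> HK; elim/ltn_ind => k IHk.
have [kK|Kk] := leqP k K; first by exists k => //; rewrite F_refl.
(* A return after [j] steps puts the path from [(-k, x)] at [(j - k, x)], where the induction
   hypothesis for [k - j] takes over. *)
have /existsNP[j /not_implyP[/andP[j0 jk] /contrapT]] := HK _ (ltnW Kk).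
rewrite F_shift ?add0r //= => Fj.
have [|i iK [ikj Fi]] := IHk (k - j)%N; first by lia.
exists i => //; split; first by lia.
rewrite (F_trans (j%:Z - k%:Z)); [|lia|lia].
by rewrite Fj -[RHS]Fi; congr (F _ _ (_, _) _); lia.
Qed.

Lemma coalescence z x (K : nat) : connected_graph h z ->
  (forall k, (K <= k)%N -> ~ no_return x k (shift (- k%:Z) z)) ->
  exists u : nat, forall k : nat, F h z (- k%:Z, x) u%:Z = F h z (0, x) u%:Z.
Proof.
move=> cz HK.
have [u Hu] : exists u : nat, forall k : nat, (k <= K)%N ->
    F h z (- k%:Z, x) u%:Z = F h z (0, x) u%:Z.
  elim: (K) => [|n [u IHn]].
    by exists 0%N => k; rewrite leqn0 => /eqP ->; rewrite oppr0.
  have [r [r1 r2 Hr]] := connected_coalesce cz (- n.+1%:Z) 0 x x.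
  exists (maxn u `|r|%N) => k; rewrite leq_eqVlt => /orP[/eqP ->|kn].
    by apply: Hr; lia.
  rewrite (F_trans u%:Z); [|lia|lia].
  by rewrite IHn // -(F_trans u%:Z) //; lia.
exists u => k; have [j jK [jk Fj]] := finite_window HK k.
by rewrite (F_trans (- j%:Z)) ?Fj ?Hu //; lia.
Qed.

(** * Limits from the past and the path they form *)

Definition converges x z y : Prop :=
  exists N : nat, forall n, (N <= n)%N -> F h z (- n%:Z, x) 0 = y.

Lemma converges_unique x z y y' : converges x z y -> converges x z y' -> y = y'.
Proof.
move=> [N HN] [M HM]; rewrite -(HN (maxn N M)) ?leq_maxl//.
by rewrite HM ?leq_maxr.
Qed.

(** One more time step applies [h] to the limit. Convergence thus persists under the shift, as
    [ae_shift_monotone] requires. *)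
Lemma converges_shift1 x z y :
  converges x z y -> converges x (shift 1 z) (h (y, z 0)).
Proof.
move=> [N HN]; exists N.+1 => -[//|n] Nn; rewrite F_shift; last by lia.
have -> : - n.+1%:Z + 1 = - n%:Z by lia.
rewrite F_step; last by lia.
by rewrite HN.
Qed.

(** The default [x] where there is no limit gives a function of every sequence, so that the limit
    path commutes with shifts everywhere and not only almost surely. *)
Definition past_limit x z : S := xget x [set y | converges x z y].

Lemma past_limitE x z y : converges x z y -> past_limit x z = y.
Proof.
by move=> cy; apply: xget_unique => // y' /converges_unique; apply.
Qed.

Definition limit_path x z (t : int) : S := past_limit x (shift t z).

Lemma limit_path_shift x s z : limit_path x (shift s z) = shift s (limit_path x z).
Proof. by apply/funext => t; rewrite /limit_path shiftD. Qed.

Lemma limit_path_step x z t y : converges x (shift t z) y ->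
  limit_path x z (t + 1) = h (limit_path x z t, z t).
Proof.
move=> cy; rewrite /limit_path (past_limitE cy) (addrC t) -shiftD.
by rewrite (past_limitE (converges_shift1 cy)) /shift add0r.
Qed.

(** At some time [s] before [t - N] the path [X] is at [x]; from there on it is the path from
    [(s, x)], whose state at time [t] is already the limit. *)
Lemma limit_path_unique x z (X : int -> S) :
  (forall t, exists y, converges x (shift t z) y) ->
  (forall t, X (t + 1) = h (X t, z t)) ->
  ~ has_lbound [set t | X t = x] ->
  forall t, X t = limit_path x z t.
Proof.
move=> cz Xstep Xx t; have [y cy] := cz t.
rewrite /limit_path (past_limitE cy); have [N HN] := cy.
have [s [Xs sN]] : exists s, X s = x /\ s < t - N%:Z.
  apply: contrapT => nos; apply: Xx; exists (t - N%:Z) => s /= Xs.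
  by rewrite leNgt; apply/negP => sN; apply: nos; exists s.
have /int_geP[n tn] : s <= t by lia.
rewrite (path_F Xstep (t := s)) ?Xs; last by lia.
rewrite -(HN n); last by lia.
by rewrite F_shift; [congr (F _ _ (_, _) _)|]; lia.
Qed.

(** The limit path merges with the path from [(0, x)], which keeps returning to [x]; here [x] may
    differ from the state [x0] that defines the limit. *)
Lemma limit_path_forward x0 z x :
  connected_graph h z -> (forall t, exists y, converges x0 (shift t z) y) ->
  recurrent_paths z x ->
  forall m, exists2 r, m <= r & limit_path x0 z r = x.
Proof.
move=> cz conv rx m.
have step t : limit_path x0 z (t + 1) = h (limit_path x0 z t, z t).
  by have [y /limit_path_step] := conv t.
have [r0 [r00 _ Hr]] := connected_coalesce cz 0 0 (limit_path x0 z 0) x.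
have [r rm [r_ge0 Fr]] := recurrent_paths_unbounded rx 0 (Num.max m r0).
exists r; first by lia.
by rewrite (path_F step (t := 0)) ?Hr //; lia.
Qed.

End Trajectories.

(** * Measurability on the path space *)

Lemma sigma_process_gen {O : Type} {d} {T : measurableType d} (I : set int)
    (X : int -> O -> T) t (B : set T) :
  I t -> measurable B -> sigma_process I X (X t @^-1` B).
Proof.
move=> It mB; apply: sub_sigma_algebra; exists t => //.
by exists B => //; rewrite setTI.
Qed.

(** The sets with measurable preimage form a sigma-algebra, so coordinates suffice to test a map
    into a path space. *)
Lemma sigma_process_preimage {d} {O : measurableType d} {O' : Type} {d'}
    {T : measurableType d'} (J : set int) (Y : int -> O' -> T) (Phi : O -> O') :
  (forall t B, J t -> measurable B -> measurable (Phi @^-1` (Y t @^-1` B))) ->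
  forall A, sigma_process J Y A -> measurable (Phi @^-1` A).
Proof.
move=> mPhi; apply: (@smallest_sub _ _ _ [set A | measurable (Phi @^-1` A)]);
  last by move=> _ [t Jt [B mB <-]] /=; rewrite setTI; exact: mPhi.
split => [|A' mA'|A' mA'] /=; first by rewrite preimage_set0.
  by rewrite setTD preimage_setC; exact: measurableC.
by rewrite preimage_bigcup; exact: bigcupT_measurable.
Qed.

Section PathSpace.
Context {dX : measure_display} {Xi : measurableType dX}.

Local Notation coord := (fun (t : int) (z : int -> Xi) => z t).

(** Naming the generators gives the past before [u] a measurable type of its own, to which the
    generic closure lemmas apply. *)
Definition past_sets (u : int) : set (set (int -> Xi)) :=
  \bigcup_(t in [set t | t < u]) preimage_set_system setT (coord t) measurable.

Local Notation past u := (g_sigma_algebraType (past_sets u)).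

Definition past_measurable (u : int) (A : set (int -> Xi)) : Prop :=
  measurable (A : set (past u)).

Lemma past_measurable_le u v : u <= v -> past_measurable u `<=` past_measurable v.
Proof.
move=> uv; apply: sub_sigma_algebra2; apply: bigcup_subset => t /= tu.
exact: lt_le_trans uv.
Qed.

Lemma past_measurable_product u : past_measurable u `<=` product_measurable.
Proof. by apply: sub_sigma_algebra2; exact: bigcup_subset. Qed.

Lemma past_measurable_shift u s A :
  past_measurable u A -> past_measurable (u + s) (shift s @^-1` A).
Proof.
apply: (@sigma_process_preimage _ (past (u + s)) _ _ _ _ coord (shift s)).
move=> t B /= tu mB; apply: (sigma_process_gen (X := coord)) => //=; lia.
Qed.

Lemma past_measurable_coord u t (B : set Xi) :
  t < u -> measurable B -> past_measurable u [set z | B (z t)].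
Proof. exact: sigma_process_gen. Qed.

Lemma past_measurable_cst u (Q : Prop) : past_measurable u [set _ | Q].
Proof.
have [q|nq] := pselect Q.
  by rewrite (_ : mkset _ = setT); [exact: measurableT|apply/seteqP; split].
by rewrite (_ : mkset _ = set0); [exact: measurable0|apply/seteqP; split].
Qed.

Section Sections.
Context {dS : measure_display} {S : measurableType dS}.
Context (S_countable : countable [set: S]).
Context (h : S * Xi -> S).
Context (mh : forall x y, measurable [set e | h (x, e) = y]).

Lemma past_measurable_F t x s y : t <= s ->
  past_measurable s [set z | F h z (t, x) s = y].
Proof.
move=> /int_geP[n ->]; elim: n y => [|n IHn] y.
  rewrite addr0 (_ : mkset _ = [set _ | x = y]); first exact: past_measurable_cst.
  by apply/seteqP; split => z; rewrite /= F_refl.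
have -> : t + n.+1%:Z = t + n%:Z + 1 by lia.
(* Split over the countably many states [y'] at time [t + n]; the only new coordinate is
   [z (t + n)], still strictly before [t + n.+1]. *)
rewrite (_ : mkset _ = \bigcup_y' ([set z | F h z (t, x) (t + n%:Z) = y'] `&`
    [set z | [set e | h (y', e) = y] (z (t + n%:Z))])); last first.
  have ts : t <= t + n%:Z by lia.
  apply/seteqP; split => [z /=|z [y' _ /= [<-]]]; rewrite F_step //.
  by move=> hy; exists (F h z (t, x) (t + n%:Z)).
apply: (@countable_bigcupT_measurable _ (past _)) => // y'.
apply: measurableI; last by apply: past_measurable_coord => //; lia.
by apply: (@past_measurable_le (t + n%:Z)); [lia|exact: IHn].
Qed.

Lemma past_measurable_converges x y :
  past_measurable 0 [set z | converges h x z y].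
Proof.
rewrite (_ : mkset _ = \bigcup_N \bigcap_(n in [set n | (N <= n)%N])
    [set z | F h z (- n%:Z, x) 0 = y]); last first.
  by apply/seteqP; split => z [N] => [HN|_ HN]; exists N.
apply: (@bigcupT_measurable _ (past 0)) => N.
apply: (@bigcap_measurableType _ (past 0)) => n _.
by apply: past_measurable_F; lia.
Qed.

Lemma past_measurable_convergent x :
  past_measurable 0 [set z | exists y, converges h x z y].
Proof.
rewrite (_ : mkset _ = \bigcup_y [set z | converges h x z y]); last first.
  by apply/seteqP; split => z [y] => [cy|_ cy]; exists y.
apply: (@countable_bigcupT_measurable _ (past 0)) => // y.
exact: past_measurable_converges.
Qed.

Lemma past_measurable_past_limit x y :
  past_measurable 0 [set z | past_limit h x z = y].
Proof.
(* The second set accounts for the default value [x] off the convergence event. *)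
rewrite (_ : mkset _ = [set z | converges h x z y] `|`
    (~` [set z | exists y', converges h x z y'] `&` [set _ | x = y])); last first.
  apply/seteqP; split => z /=.
    have [[y' cy']|nc] := pselect (exists y', converges h x z y').
      by rewrite (past_limitE cy') => <-; left.
    by rewrite /past_limit xgetPN => [xy|y' cy']; [right|apply: nc; exists y'].
  case=> [/past_limitE//|[nc <-]].
  by rewrite /past_limit xgetPN // => y' cy'; apply: nc; exists y'.
apply: (@measurableU _ (past 0)); first exact: past_measurable_converges.
apply: (@measurableI _ (past 0)); last exact: past_measurable_cst.
by apply: (@measurableC _ (past 0)); exact: past_measurable_convergent.
Qed.

Lemma past_measurable_limit_path x t (B : set S) :
  past_measurable t [set z | B (limit_path h x z t)].
Proof.
rewrite (_ : mkset _ = \bigcup_(y in B) [set z | limit_path h x z t = y]); last first.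
  by apply/seteqP; split => z /= => [Bl|[y By ->]//]; exists (limit_path h x z t).
rewrite bigcup_mkcond; apply: (@countable_bigcupT_measurable _ (past t)) => // y.
case: ifP => _; last exact: (@measurable0 _ (past t)).
by have := past_measurable_shift (s := t) (past_measurable_past_limit x y); rewrite add0r.
Qed.

Lemma product_measurable_limit_path x A :
  product_measurable A -> product_measurable (limit_path h x @^-1` A).
Proof.
apply: (@sigma_process_preimage _ (g_sigma_algebraType
  (\bigcup_(t in setT) preimage_set_system setT (coord t) measurable))).
move=> t B _ _; apply: (@past_measurable_product t).
exact: past_measurable_limit_path.
Qed.

Lemma product_measurable_no_return x k : product_measurable (no_return h x k).
Proof.
rewrite (_ : no_return _ _ _ = \bigcap_(j in [set j : nat | (0 < j <= k)%N])
    ~` [set z | F h z (0, x) j%:Z = x]); last by [].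
apply: (@bigcap_measurableType _ (g_sigma_algebraType
  (\bigcup_(t in setT) preimage_set_system setT (coord t) measurable))).
move=> j _; apply: measurableC; apply: past_measurable_product.
exact: past_measurable_F.
Qed.

End Sections.
End PathSpace.

(** * Almost sure events and integrals *)

Lemma ae_forall_int d (O : measurableType d) (R : realType)
    (P : {measure set O -> \bar R}) (Q : int -> O -> Prop) :
  (forall t, \forall w \ae P, Q t w) -> \forall w \ae P, forall t, Q t w.
Proof.
move=> HQ; have pos : \forall w \ae P, forall n : nat, Q n%:Z w.
  exact: ae_foralln.
have neg : \forall w \ae P, forall n : nat, Q (- n%:Z) w.
  exact: ae_foralln.
apply: filterS2 pos neg => w Qp Qn t.
by have [->|->] : t = `|t|%N%:Z \/ t = - `|t|%N%:Z by lia.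
Qed.

Lemma probability_ae d (O : measurableType d) (R : realType)
    (P : probability O R) (A : set O) : measurable A ->
  (\forall w \ae P, A w) <-> P A = 1%E.
Proof.
move=> mA; apply: (iff_trans (negligibleP P (measurableC mA))).
split=> PA; last by rewrite [LHS]probability_setC// PA subee.
rewrite -(setCK A) probability_setC; last exact: measurableC.
by rewrite [X in (_ - X)%E]PA sube0.
Qed.

Lemma borel_cantelli d (O : measurableType d) (R : realType)
    (P : {measure set O -> \bar R}) (A : (set O)^nat) :
  (forall n, measurable (A n)) -> (\sum_(n <oo) P (A n) < +oo)%E ->
  \forall w \ae P, exists N : nat, forall n, (N <= n)%N -> ~ A n w.
Proof.
move=> mA sA; exists (lim_sup_set A); split.
- apply: bigcapT_measurable => n; exact: bigcup_measurable.
- exact: lim_sup_set_cvg0.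
- move=> w /= nw n _; apply: contrapT => nA; apply: nw; exists n => m nm Am.
  by apply: nA; exists m.
Qed.

(** The integral of a nonnegative function is a supremum over the simple functions below it, hence
    monotone without measurability; the larger function will be the return time. *)
Lemma ge0_le_integral_nonmeasurable d (O : measurableType d) (R : realType)
    (P : {measure set O -> \bar R}) (f g : O -> \bar R) :
  (forall w, 0 <= f w <= g w)%E -> (\int[P]_w f w <= \int[P]_w g w)%E.
Proof.
move=> fg; have f0 w : (0 <= f w)%E by case/andP: (fg w).
have lfg w : (f w <= g w)%E by case/andP: (fg w).
rewrite !ge0_integralTE//; last by move=> w; exact: le_trans (lfg w).
apply: le_ereal_sup => _ [k kf <-]; exists k => // w.
exact: le_trans (kf w) (lfg w).
Qed.

(** A pointwise form of the tail sum [tau = sum_k 1(tau > k)]: every partial sum is bounded by an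
    arbitrary return time [m]. *)
Lemma no_return_le_return_time (S : choiceType) (T : Type) (h : S * T -> S)
    (R : realType) z x :
  (\sum_(k <oo) (\1_(no_return h x k) z : R)%:E <= return_time h R z x)%E.
Proof.
apply/ereal_infP => _ [s [s0 Fs] <-]; have /int_geP[m] : 0 <= s by lia.
rewrite add0r => sm; rewrite {s}sm in s0 Fs *.
apply: lime_le; first exact: is_cvg_nneseries.
apply: nearW => n; rewrite sumEFin lee_fin.
(* The minimum makes the induction work: each index below [m] adds at most 1, and from [m] on the
   return at time [m > 0] makes the indicators vanish. *)
suff : \sum_(0 <= i < n) (\1_(no_return h x i) z : R) <= (minn n m)%:R.
  by move=> /le_trans; apply; rewrite -[leRHS]/(m%:R) ler_nat geq_minr.
elim: n => [|n IHn]; first by rewrite big_geq.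
rewrite big_nat_recr //=; have [nm|mn] := ltnP n m.
  have -> : minn n.+1 m = (minn n m).+1 by lia.
  by rewrite -natr1 lerD // indicE lern1 leq_b1.
rewrite indicE memNset ?addr0; last by move=> /(_ m); apply=> //; lia.
by rewrite (_ : minn n.+1 m = minn n m) //; lia.
Qed.

(** * Consequences of stationarity *)

Section Stationary.
Context {d : measure_display} {O : measurableType d} {R : realType}.
Context (P : probability O R).
Context {dX : measure_display} {Xi : measurableType dX}.
Context (xi : int -> O -> Xi).
Context (mxi : forall t, measurable_fun setT (xi t)).
Context (xi_stationary : stationary P xi).

Lemma measurable_path_event (A : set (int -> Xi)) :
  product_measurable A -> measurable [set w | A (xi ^~ w)].
Proof.
apply: (@sigma_process_preimage _ _ _ _ _ _ _ (fun w => xi ^~ w)).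
by move=> t B _ mB; rewrite -[X in measurable X]setTI; exact: mxi.
Qed.

Lemma product_measurable_shift s (A : set (int -> Xi)) :
  product_measurable A -> product_measurable (shift s @^-1` A).
Proof.
apply: (@sigma_process_preimage _ (g_sigma_algebraType (\bigcup_(t in setT)
  preimage_set_system setT (fun z : int -> Xi => z t) measurable))).
move=> t B _ mB.
exact: (sigma_process_gen (X := fun (t : int) (z : int -> Xi) => z t)).
Qed.

(* The events [shift n xi in A] increase with n and all have the same
   probability, which is thus the probability of their union. *)
Lemma ae_shift_monotone (A : set (int -> Xi)) : product_measurable A ->
  (forall z, A z -> A (shift 1 z)) ->
  (\forall w \ae P, exists n : nat, A (shift n%:Z (xi ^~ w))) ->
  \forall w \ae P, forall s, A (shift s (xi ^~ w)).
Proof.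
move=> mA A1 aeA; apply: ae_forall_int => s.
have mAs r := measurable_path_event (product_measurable_shift r mA).
pose B (n : nat) := [set w | A (shift n%:Z (xi ^~ w))].
have mB n : measurable (B n) by exact: mAs.
have mU : measurable (\bigcup_n B n) by exact: bigcupT_measurable.
have PU : P (\bigcup_n B n) = 1%E.
  apply/(probability_ae P mU); apply: filterS aeA => w [n An].
  by exists n.
have PB r : P [set w | A (shift r (xi ^~ w))] = P [set w | A (xi ^~ w)].
  exact: xi_stationary.
have ndB : nondecreasing_seq B.
  apply/nondecreasing_seqP => n; apply/subsetPset => w /A1.
  by rewrite shiftD -intS.
apply/(probability_ae P (mAs s)); rewrite PB -PU.
have BE : (fun n => P (B n)) = cst (P [set w | A (xi ^~ w)]).
  by apply/funext => n; exact: PB.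
have Bcvg : (fun n => P (B n)) @ \oo --> P (\bigcup_n B n).
  exact: nondecreasing_cvg_mu.
rewrite BE in Bcvg; apply: cvg_unique Bcvg; [exact: ereal_hausdorff|exact: cvg_cst].
Qed.

Lemma ae_shift (A : set (int -> Xi)) : product_measurable A ->
  (\forall w \ae P, A (xi ^~ w)) ->
  \forall w \ae P, forall s, A (shift s (xi ^~ w)).
Proof.
move=> mA aeA; apply: ae_forall_int => s.
have mAs := measurable_path_event (product_measurable_shift s mA).
apply/(probability_ae P mAs).
have /(probability_ae P (measurable_path_event mA)) <- := aeA.
exact: xi_stationary.
Qed.

(** * Positive recurrence and almost sure convergence *)

Section Recurrence.
Context {dS : measure_display} {S : measurableType dS}.
Context (S_countable : countable [set: S]).
Context (h : S * Xi -> S).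
Context (mh : forall x y, measurable [set e | h (x, e) = y]).
Context (x : S) (x_recurrent : positive_recurrent P h xi x).

(** Exchanging sum and integral bounds the series by the expected return time. *)
Lemma no_return_summable :
  (\sum_(k <oo) P [set w | no_return h x k (xi ^~ w)] < +oo)%E.
Proof.
have mB k := measurable_path_event (product_measurable_no_return S_countable mh x k).
apply: le_lt_trans x_recurrent.
under eq_eseriesr => k _ do rewrite -[X in P X]setIT -integral_indic//.
rewrite -integral_nneseries //; last first.
  by move=> k; apply/measurable_EFinP; exact: measurable_indic.
apply: (@ge0_le_integral_nonmeasurable _ _ _ P) => w; apply/andP; split.
  by apply: nneseries_ge0 => *; rewrite lee_fin.
exact: (no_return_le_return_time h R (xi ^~ w)).
Qed.

(** Borel-Cantelli gives a finite return time from time 0, and stationarity carries this to every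
    starting time. *)
Lemma ae_recurrent_paths : \forall w \ae P, recurrent_paths h (xi ^~ w) x.
Proof.
have mB k := measurable_path_event (product_measurable_no_return S_countable mh x k).
have mR : product_measurable (~` \bigcap_k no_return h x k).
  rewrite setC_bigcap; apply: sigma_algebra_bigcup => k.
  have := product_measurable_no_return S_countable mh x k.
  exact: sigma_algebraC.
have aeR : \forall w \ae P, (~` \bigcap_k no_return h x k) (xi ^~ w).
  apply: filterS (borel_cantelli mB no_return_summable) => w [N HN].
  by move=> /= /(_ N Logic.I); exact: HN.
apply: filterS (ae_shift mR aeR) => w Hw t.
have /existsNP[k /not_implyP[_ /existsNP[j]]] := Hw t.
move=> /not_implyP[/andP[j0 _] /contrapT]; rewrite F_shift // add0r addrC => Fj.
by exists j.
Qed.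

(** Shifting by [-k] preserves the probability of the [k]-th event, so the series stays finite and
    Borel-Cantelli applies. *)
Lemma ae_backward_return : \forall w \ae P, exists K : nat,
  forall k, (K <= k)%N -> ~ no_return h x k (shift (- k%:Z) (xi ^~ w)).
Proof.
have mB k := product_measurable_no_return S_countable mh x k.
apply: (borel_cantelli (A := fun k : nat =>
  [set w | no_return h x k (shift (- k%:Z) (xi ^~ w))])) => [k|].
  exact: (measurable_path_event (product_measurable_shift (- k%:Z) (mB k))).
apply: le_lt_trans no_return_summable; rewrite le_eqVlt; apply/orP; left.
by apply/eqP; apply: eq_eseriesr => k _; exact: xi_stationary.
Qed.

Lemma ae_converges : (\forall w \ae P, connected_graph h (xi ^~ w)) ->
  \forall w \ae P, forall t, exists y, converges h x (shift t (xi ^~ w)) y.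
Proof.
move=> cG; apply: (ae_shift_monotone (A := [set z | exists y, converges h x z y])).
- apply: past_measurable_product.
  exact: past_measurable_convergent.
- by move=> z [y cy]; exists (h (y, z 0)); exact: converges_shift1.
apply: filterS2 cG ae_backward_return => w cw [K HK].
have [u Hu] := coalescence cw HK.
(* The shift is by the coalescence time [u]. Seen from time [u], a start [n] steps back is at
   [-(n - u)], which is a start covered by [Hu] once [u <= n]. *)
exists u, (F h (xi ^~ w) (0, x) u%:Z), u => n un.
rewrite F_shift ?add0r; last by lia.
by rewrite -(Hu (n - u)%N); congr (F _ _ (_, _) _); lia.
Qed.

End Recurrence.

Lemma ae_limit_path_recurrent {dS} {S : measurableType dS}
    (S_countable : countable [set: S]) (h : S * Xi -> S)
    (mh : forall x y, measurable [set e | h (x, e) = y]) (x0 x : S) :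
  (\forall w \ae P, connected_graph h (xi ^~ w)) ->
  positive_recurrent P h xi x0 -> positive_recurrent P h xi x ->
  bi_recurrent P (fun t w => limit_path h x0 (xi ^~ w) t) x.
Proof.
move=> cG x0r xr.
have fwd : \forall w \ae P, forall m, exists2 r, m <= r &
    limit_path h x0 (xi ^~ w) r = x.
  have conv := ae_converges S_countable mh x0r cG.
  have rec := ae_recurrent_paths S_countable mh xr.
  apply: filterS3 cG conv rec => w cw convw recw.
  exact: limit_path_forward.
(* A visit to [x] at some time [<= 0]. This event persists under the shift and holds once the shift
   reaches a forward visit, so stationarity gives it at all times. *)
pose A := [set z | exists n : nat, limit_path h x0 z (- n%:Z) = x].
have bwd : \forall w \ae P, forall s, A (shift s (xi ^~ w)).
  apply: ae_shift_monotone.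
  - rewrite (_ : A = \bigcup_(n : nat)
        [set z | [set x] (limit_path h x0 z (- n%:Z))]); last first.
      by apply/seteqP; split => z [n] => [An|_ An]; exists n.
    apply: sigma_algebra_bigcup => n; apply: past_measurable_product.
    exact: past_measurable_limit_path.
  - move=> z [n An]; exists n.+1; rewrite limit_path_shift /shift -[RHS]An.
    by congr (limit_path _ _ _ _); lia.
  - apply: filterS fwd => w /(_ 0)[r /int_geP[n ->]]; rewrite add0r => Ar.
    by exists n, 0%N; rewrite limit_path_shift /shift oppr0 add0r.
apply: filterS2 fwd bwd => w fw bw; split=> -[m mb].
  have [r mr rx] := fw (m + 1); have := mb r rx; lia.
have [n] := bw (m - 1); rewrite limit_path_shift /shift => nx.
by have := mb _ nx; lia.
Qed.

End Stationary.

(** * The path beta as the limit path of the sequence xi *)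

Theorem corollary4p7 (R : realType)
    (d : measure_display) (O : measurableType d) (P : probability O R)
    (dS : measure_display) (S : measurableType dS)
    (S_countable : countable [set: S])
    (S_discrete : forall A : set S, measurable A)
    (Xi : completeMetricType R) (Xi_separable : separable_space Xi)
    (h : S * borelType Xi -> S) (h_measurable : measurable_fun setT h)
    (xi : int -> O -> borelType Xi)
    (xi_measurable : forall t, measurable_fun setT (xi t))
    (xi_stationary : stationary P xi) (xi_ergodic : ergodic P xi)
    (xstar : S) (xstar_recurrent : positive_recurrent P h xi xstar)
    (G_connected : \forall w \ae P, connected_graph h (xi ^~ w)) :
  exists beta : int -> O -> S,
    (state_path P h xi beta /\ bi_recurrent P beta xstar) /\
    (forall beta' : int -> O -> S,
       state_path P h xi beta' -> bi_recurrent P beta' xstar ->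
       \forall w \ae P, forall t, beta' t w = beta t w) /\
    shift_covariant_path P h xi beta /\
    stationary P beta /\
    (forall (t : int) (B : set S), measurable B ->
       sigma_process [set s | s < t] xi (beta t @^-1` B)) /\
    (forall x : S, positive_recurrent P h xi x -> bi_recurrent P beta x).
Proof.
have mh x y : measurable [set e | h (x, e) = y].
  rewrite -[X in measurable X]setTI.
  have := measurableT_comp h_measurable (pair1_measurable x).
  by move=> /(_ measurableT [set y]); apply.
have conv := ae_converges xi_measurable xi_stationary S_countable mh
  xstar_recurrent G_connected.
have mb t B : past_measurable t [set z | B (limit_path h xstar z t)].
  exact: past_measurable_limit_path.
have edgeE z (X : int -> S) t :
    edge h z (t, X t) (t + 1, X (t + 1)) <-> X (t + 1) = h (X t, z t).
  by rewrite /edge /fplus /=; split=> [/eqP[->]//|->].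
have bstep : \forall w \ae P, forall t, edge h (xi ^~ w)
    (t, limit_path h xstar (xi ^~ w) t)
    (t + 1, limit_path h xstar (xi ^~ w) (t + 1)).
  apply: filterS conv => w convw t; apply/edgeE.
  by have [y cy] := convw t; exact: limit_path_step cy.
have brec x : positive_recurrent P h xi x ->
    bi_recurrent P (fun t w => limit_path h xstar (xi ^~ w) t) x.
  exact: (ae_limit_path_recurrent xi_measurable xi_stationary S_countable mh).
exists (fun t w => limit_path h xstar (xi ^~ w) t).
split; [|split; [|split; [|split; [|split]]]].
- split; last exact: brec.
  split => // t _ B _; rewrite setTI.
  apply: (measurable_path_event xi_measurable
    (A := [set z | B (limit_path h xstar z t)])).
  by apply: past_measurable_product; exact: mb.
- move=> beta' [_ sp] br; apply: filterS3 conv sp br => w convw spw [_ brw].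
  apply: (limit_path_unique (X := beta' ^~ w) convw) => // t.
  exact: (edgeE _ (beta' ^~ w) t).1 (spw t).
- exists (fun z => path_digraph (limit_path h xstar z)); split => //.
  + split.
    * move=> [t x].
      rewrite (_ : mkset _ = [set z | [set x] (limit_path h xstar z t)]).
        by apply: past_measurable_product; exact: mb.
      apply/seteqP; split => z /=; first by move=> [s _ [<-]].
      by move=> <-; exists t.
    * move=> [[t x] [t' x']].
      rewrite (_ : mkset _ = [set z | [set x] (limit_path h xstar z t)] `&`
          [set z | [set x'] (limit_path h xstar z (t + 1))] `&`
          [set _ | t' = t + 1]); last first.
        apply/seteqP; split => z /=; first by move=> [s _ [<- <- <- <-]].
        by move=> [[<- <-] ->]; exists t.
      apply: (@past_measurable_product _ _ (t + 1)).
      apply: (@measurableI _ (g_sigma_algebraType _)); last exact: past_measurable_cst.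
      apply: (@measurableI _ (g_sigma_algebraType _)); last exact: mb.
      by apply: (@past_measurable_le _ _ t); [lia|exact: mb].
    * apply: filterS bstep => w ew [t x] [t' x'] [s _ [<- <- <- <-]].
      by split => //; [exists s|exists (s + 1)].
  (* Covariance holds for every sequence: the vertex of the shifted path at time [t] is the vertex
     of the original path at [t + s], moved by [-s]. *)
  + move=> s; apply: aeW => w; rewrite limit_path_shift.
    set X := limit_path _ _ _; rewrite /translate /path_digraph /=; congr Digraph.
      apply/seteqP; split => [_ [t _ <-]|_ [_ [t _ <-] <-]].
        exists (t + s, X (t + s)); first by exists (t + s).
        by rewrite /translate_vertex /= addrK.
      exists (t - s) => //.
      by rewrite /shift /translate_vertex /= subrK.
    apply/seteqP; split => [_ [t _ <-]|_ [_ [t _ <-] <-]].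
      exists ((t + s, X (t + s)), (t + s + 1, X (t + s + 1))).
        by exists (t + s).
      rewrite /shift /translate_vertex /= addrK.
      by congr ((_, _), (_, X _)); lia.
    exists (t - s) => //; rewrite /shift /translate_vertex /= subrK.
    by congr ((_, _), (_, X _)); lia.
(* Since [limit_path] commutes with shifts, an event on beta is an event on xi whose shifts
   correspond. *)
- move=> s A mA.
  have := xi_stationary s _ (product_measurable_limit_path S_countable mh xstar mA).
  by under [X in P X = _]eq_fun do rewrite /= limit_path_shift.
- move=> t B _.
  (* Pull the past before [t] on the path space back along the sequence xi. *)
  apply: (@sigma_process_preimage _ (g_sigma_algebraType (\bigcup_(s in [set s | s < t])
     preimage_set_system setT (xi s) measurable)) _ _ _ _ _ (fun w => xi ^~ w)
     _ _ (mb t B)).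
  by move=> s C st mC; exact: sigma_process_gen.
- exact: brec.
Qed.
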